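(* Let $r\ge 3$, and let $m$ and $t$ be positive integers with $\binom{t-1}{r}\le m\le\binom{t-1}{r}+\binom{t-2}{r-1}-2^{r-2}\left(\binom{t-2}{r-2}-1\right)$. Let $G$ be an $r$-graph on $t$ vertices with $m$ edges which contains a clique of order $t-2$. Then $\lambda(G)\le\lambda([t-1]^{(r)})$.
   Context: An $r$-graph $G$ has vertex set $[n]$ and edge set $E\subseteq[n]^{(r)}$ ($r$-element subsets); a clique of order $p$ is a set of $p$ vertices all of whose $r$-subsets are edges; $[p]^{(r)}$ is the complete $r$-graph on $[p]$. For $\vec x\in\mathbb R^n$, $\lambda(G,\vec x)=\sum_{i_1\cdots i_r\in E}x_{i_1}\cdots x_{i_r}$, and the Lagrangian is $\lambda(G)=\max\{\lambda(G,\vec x): x_i\ge0,\ \sum_ix_i=1\}$. *)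

(* Defs.v *)
From mathcomp Require Import all_boot all_order all_algebra.
From mathcomp Require Import all_classical all_reals all_analysis.

Set Implicit Arguments.
Unset Strict Implicit.
Unset Printing Implicit Defensive.
Import Order.TTheory GRing.Theory Num.Theory.
Import numFieldNormedType.Exports.

Local Open Scope classical_set_scope.
Local Open Scope ring_scope.

Record r_graph (r n : nat) := RGraph {
  edges : {set {set 'I_n}};
  edges_card : forall e, e \in edges -> #|e| = r }.

Definition is_clique (r n : nat) (G : r_graph r n) (K : {set 'I_n}) : Prop :=
  forall e : {set 'I_n}, e \subset K -> #|e| = r -> e \in edges G.

Definition contains_clique (r n : nat) (G : r_graph r n) (p : nat) : Prop :=
  exists K : {set 'I_n}, #|K| = p /\ is_clique G K.

Lemma complete_card (r p : nat) (e : {set 'I_p}) :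
  e \in [set e : {set 'I_p} | #|e| == r]%SET -> #|e| = r.
Proof. by rewrite inE => /eqP. Qed.

Definition complete_graph (r p : nat) : r_graph r p :=
  RGraph (@complete_card r p).

Section Lagrangian.
Variable R : realType.

Definition lagr_poly (r n : nat) (G : r_graph r n) (x : 'rV[R]_n) : R :=
  \sum_(e in edges G) \prod_(i in e) x 0 i.

Definition simplex (n : nat) : set 'rV[R]_n :=
  [set x | (forall i, 0 <= x 0 i) /\ \sum_(i < n) x 0 i = 1].

(* The supremum is attained as soon as there is a vertex: see
   [lagrangian_max] below.  For n = 0 the simplex is empty and the value is 0. *)
Definition lagrangian (r n : nat) (G : r_graph r n) : R :=
  sup [set lagr_poly G x | x in @simplex n].

Lemma lagr_poly_continuous (r n : nat) (G : r_graph r n) :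
  continuous (lagr_poly G).
Proof.
apply: continuous_big => [|e _]; first exact: add_continuous.
apply: continuous_big => [|i _]; first exact: mul_continuous.
exact: coord_continuous.
Qed.

Lemma simplex_compact (n : nat) : compact (@simplex n).
Proof.
have sum_cont : continuous (fun x : 'rV[R]_n => \sum_(i < n) x 0 i).
  apply: continuous_big => [|i _]; first exact: add_continuous.
  exact: coord_continuous.
have box : compact [set x : 'rV[R]_n | forall i, `[0, 1]%classic (x ord0 i)].
  apply: (@rV_compact R n (fun=> `[0, 1]%classic)) => _.
  exact: segment_compact.
have hyp : closed [set x : 'rV[R]_n | \sum_(i < n) x 0 i = 1].
  have /continuous_closedP/(_ [set y | y = 1]) := sum_cont; apply.
  exact: closed_eq.
rewrite (_ : @simplex n = [set x | \sum_(i < n) x 0 i = 1] `&`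
    [set x | forall i, `[0, 1]%classic (x ord0 i)]).
  by rewrite setIC; apply: compact_closedI.
apply/seteqP; split=> x /=.
  move=> [x0 x1]; split=> // i; rewrite in_itv /= x0 -x1 (bigD1 i) //=.
  by rewrite lerDl sumr_ge0.
by move=> [x1 x0]; split=> // i; have := x0 i; rewrite in_itv /= => /andP[].
Qed.

Lemma simplex_nonempty (n : nat) : (0 < n)%N -> @simplex n !=set0.
Proof.
case: n => // n _; exists (delta_mx 0 ord0); split=> [i|].
  by rewrite mxE ler0n.
rewrite (bigD1 ord0) //= big1 ?mxE ?addr0 // => i i0.
by rewrite mxE (negbTE i0) andbF.
Qed.

Lemma lagrangian_max (r n : nat) (G : r_graph r n) : (0 < n)%N ->
  (exists2 x, @simplex n x & lagr_poly G x = lagrangian G) /\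
  (forall x, @simplex n x -> lagr_poly G x <= lagrangian G).
Proof.
move=> n0; have [c cS cmax] := EVT_max_rV (simplex_nonempty n0)
  (@simplex_compact n) (continuous_subspaceT (@lagr_poly_continuous r n G)).
rewrite inE in cS.
have ubc : ubound [set lagr_poly G x | x in @simplex n] (lagr_poly G c).
  by move=> _ [x xS <-]; apply: cmax; rewrite inE.
have ub x : @simplex n x -> lagr_poly G x <= lagrangian G.
  by move=> xS; apply: ub_le_sup; [exists (lagr_poly G c) | exists x].
split=> //; exists c => //; apply/eqP; rewrite eq_le ub //=.
by apply: ge_sup => //; exists (lagr_poly G c), c.
Qed.

End Lagrangian.

(* Main.v *)
(* Write q = r - 2, n = t - 2, let K be the clique of order n and a, b the two
   other vertices.  Shifting edges towards heavy vertices preserves the number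
   of edges and the existence of an n-clique and does not decrease the
   Lagrangian, so we may assume that an optimal weighting x satisfies
   x_a, x_b <= x_v for all v in K.

   Let N_a, N_b be the (q+1)-subsets of K whose union with a (resp. b) is not an
   edge, and D the q-subsets of K whose union with {a, b} is an edge.  Counting
   edges gives |N_a| + |N_b| >= 2^q (C(n,q) - 1) + |D|.  Moving the weight of b
   to a shows that if lambda(G) exceeds lambda([t-1]^(r)), then
     ( * )  x_a N_a(x) + x_b N_b(x) < x_a x_b D(x).
   Let M and y be the largest and smallest weights on K, reached at i and j.

   If M <= 2y, every product in D(x) is at most 2^q y^q, every product on the
   left of ( * ) is at least x_a x_b y^q, and the count contradicts ( * ).

   If M > 2y, the first-order condition at i, j bounds (M - y) e_q(K') with
   K' = K - i - j by the weights of the edges that do not survive the replacement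
   of i by j.  The corresponding non-edges all contain j and make up only part of
   N_a and N_b; the others, of which there are at least
   2^q (C(n,q) - 1) + |D| - 2 C(n-2,q), again contradict ( * ). *)
Require Import Defs.
From mathcomp Require Import all_boot all_order all_algebra.
From mathcomp Require Import all_classical all_reals all_analysis.
From mathcomp Require Import zify ring lra.
From mathcomp Require Import fintype finset.

Set Implicit Arguments.
Unset Strict Implicit.
Unset Printing Implicit Defensive.
Import Order.TTheory GRing.Theory Num.Theory.

Local Open Scope ring_scope.

(** * Weighted sums over families of finite sets *)

Section WeightedSums.
Variables (R : realFieldType) (V : finType).
Implicit Types (x : V -> R) (S A : {set V}) (P Q : pred {set V}) (u v : V).

Definition weight x S : R := \prod_(v in S) x v.

(** With all weights equal to 1 this is a cardinality, so every identity for weighted sums is also a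
    counting formula. *)
Definition wsum x P : R := \sum_(S | P S) weight x S.

(** The elementary symmetric polynomial of degree [k] in the weights on [A]. *)
Definition esym x A k : R := wsum x [pred S : {set V} | (S \subset A) && (#|S| == k)].

Lemma weightU1 x v S : v \notin S -> weight x (v |: S) = x v * weight x S.
Proof. by move=> vS; rewrite /weight big_setU1. Qed.

Lemma eq_wsum x P Q : P =1 Q -> wsum x P = wsum x Q.
Proof. exact: eq_bigl. Qed.

Lemma wsum_split x v P :
  wsum x P = wsum x [pred S : {set V} | (v \notin S) && P S]
             + x v * wsum x [pred S : {set V} | (v \notin S) && P (v |: S)].
Proof.
rewrite /wsum (bigID (fun S => v \notin S)) /=; congr (_ + _).
  by apply: eq_bigl => S; rewrite andbC.
rewrite mulr_sumr (reindex_onto (fun S => v |: S) (fun S => S :\ v)) /=.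
  apply: eq_big => [S|S]; last first.
    by move=> /andP[_ /eqP <-]; rewrite weightU1 // setD11.
  rewrite setU11 /= andbT andbC; congr (_ && _).
  apply/eqP/idP => [<-|vS]; first by rewrite setD11.
  by rewrite setU1K.
by move=> S /andP[_]; rewrite negbK => vS; rewrite setD1K.
Qed.

(** The sum is affine in each of [x u] and [x v], and the four coefficients involve neither
    weight. *)
Lemma wsum_split2 x u v P : u != v ->
  wsum x P = wsum x [pred S : {set V} | [&& u \notin S, v \notin S & P S]]
    + x u * wsum x [pred S : {set V} | [&& u \notin S, v \notin S & P (u |: S)]]
    + x v * wsum x [pred S : {set V} | [&& u \notin S, v \notin S & P (v |: S)]]
    + x u * x v * wsum x [pred S : {set V} | [&& u \notin S, v \notin S & P (u |: (v |: S))]].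
Proof.
move=> uv; rewrite (wsum_split x v P) !(wsum_split x u [pred S : {set V} | (v \notin S) && _]) /=.
rewrite mulrDr !mulrA [x v * x u]mulrC !addrA; congr (_ + _ + _ + _ * _).
- congr (_ * _); apply: eq_wsum => S /=.
  by rewrite in_setU1 negb_or (eq_sym v) uv.
- apply: eq_wsum => S /=.
  by rewrite in_setU1 negb_or (eq_sym v) uv /= (setUCA [set v]).
Qed.

Section Nonneg.
Variable x : V -> R.
Hypothesis x0 : forall v, 0 <= x v.

Lemma weight_ge0 S : 0 <= weight x S.
Proof. exact: prodr_ge0. Qed.

Lemma wsum_ge0 P : 0 <= wsum x P.
Proof. by apply: sumr_ge0 => S _; exact: weight_ge0. Qed.

Lemma wsum_le P Q : subpred P Q -> wsum x P <= wsum x Q.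
Proof.
move=> PQ; rewrite /wsum [leRHS](bigID P) /=.
rewrite [X in _ <= X + _](eq_bigl P) ?lerDl ?sumr_ge0 // => S; rewrite ?weight_ge0 //.
by case: (boolP (P S)) => [/PQ ->//|]; rewrite andbF.
Qed.

Lemma wsum_le2 P1 P2 Q : subpred P1 Q -> subpred P2 Q ->
  (forall S, P1 S -> ~~ P2 S) -> wsum x P1 + wsum x P2 <= wsum x Q.
Proof.
move=> P1Q P2Q dis; rewrite /wsum [leRHS](bigID P1) /= lerD //.
  by apply: (@wsum_le P1 [pred S : {set V} | Q S && P1 S]) => S /= P1S; rewrite P1Q.
apply: (@wsum_le P2 [pred S : {set V} | Q S && ~~ P1 S]) => S /= P2S.
by rewrite P2Q //=; apply/negP => /dis; rewrite P2S.
Qed.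

Lemma weight_ge y A S k : 0 <= y -> (forall v, v \in A -> y <= x v) ->
  S \subset A -> #|S| = k -> y ^+ k <= weight x S.
Proof.
move=> y0 yx /subsetP SA <-; rewrite -prodr_const; apply: ler_prod => v vS.
by rewrite y0 yx // SA.
Qed.

Lemma weight_le y A S k : (forall v, v \in A -> x v <= y) ->
  S \subset A -> #|S| = k -> weight x S <= y ^+ k.
Proof.
move=> yx /subsetP SA <-; rewrite -prodr_const; apply: ler_prod => v vS.
by rewrite x0 yx // SA.
Qed.

End Nonneg.

Lemma wsum1 P : wsum (fun=> 1) P = #|P|%:R.
Proof.
rewrite /wsum (eq_bigr (fun=> 1)) ?sumr_const // => S _.
by rewrite /weight prodr_const expr1n.
Qed.

Lemma esym1 A k : esym (fun=> 1) A k = 'C(#|A|, k)%:R.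
Proof.
rewrite /esym wsum1 -cards_draws; congr (_%:R).
by apply: eq_card => S; rewrite !inE.
Qed.

Lemma wsum_ge_card x y A P k : 0 <= y ->
  (forall v, v \in A -> y <= x v) ->
  (forall S, P S -> S \subset A /\ #|S| = k) -> y ^+ k * #|P|%:R <= wsum x P.
Proof.
move=> y0 yx PA; rewrite /wsum mulr_natr -sumr_const.
by apply: ler_sum => S /PA[SA Sk]; exact: (weight_ge y0 yx).
Qed.

Lemma wsum_le_card x y A P k : (forall v, 0 <= x v) ->
  (forall v, v \in A -> x v <= y) ->
  (forall S, P S -> S \subset A /\ #|S| = k) -> wsum x P <= y ^+ k * #|P|%:R.
Proof.
move=> x0 yx PA; rewrite /wsum mulr_natr -sumr_const.
by apply: ler_sum => S /PA[SA Sk]; exact: (weight_le x0 yx).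
Qed.

(* Double counting of the pairs v \in S with #|S| = k.+1. *)
Lemma esym_step x y A k : (forall v, 0 <= x v) -> 0 <= y ->
  (forall v, v \in A -> y <= x v) ->
  (#|A| - k)%:R * y * esym x A k <= k.+1%:R * esym x A k.+1.
Proof.
move=> x0 y0 yx.
have -> : k.+1%:R * esym x A k.+1 =
    \sum_(v in A) x v * wsum x [pred S : {set V} | [&& v \notin S, S \subset A & #|S| == k]].
  rewrite /esym /wsum mulr_sumr.
  transitivity (\sum_(S : {set V} | (S \subset A) && (#|S| == k.+1))
                  \sum_(v in A | v \in S) weight x S).
    apply: eq_bigr => S /andP[SA /eqP Sk].
    rewrite sumr_const mulr_natl; congr (_ *+ _).
    rewrite -Sk; apply: eq_card => v; rewrite -[RHS]/((v \in A) && (v \in S)).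
    by case: (boolP (v \in S)) => [/(subsetP SA) ->|]; rewrite ?andbF.
  rewrite (exchange_big_dep (mem A)) /=; last by move=> ? ? _ /andP[].
  apply: eq_bigr => v vA.
  have := wsum_split x v [pred S : {set V} | [&& v \in S, S \subset A & #|S| == k.+1]].
  rewrite /wsum /= [X in _ = X + _]big_pred0 => [|S]; last by case: (v \in S).
  rewrite add0r => h; transitivity (\sum_(S : {set V} | [&& v \in S, S \subset A & #|S| == k.+1]) weight x S).
    by apply: eq_bigl => S; rewrite vA /= andbC.
  rewrite h; congr (_ * _); apply: eq_bigl => S.
  rewrite setU11 subUset sub1set vA cardsU1 /=.
  by case: (v \notin S).
rewrite /esym.
apply: (@le_trans _ _ (\sum_(v in A) y * wsum x [pred S : {set V} | [&& v \notin S, S \subset A & #|S| == k]])).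
  rewrite -[leRHS]mulr_sumr /wsum /= [in leRHS](exchange_big_dep
    (fun S : {set V} => (S \subset A) && (#|S| == k))) /=; last first.
    by move=> v S _ /and3P[_ -> ->].
  rewrite !mulr_sumr; apply: ler_sum => S /andP[SA /eqP Sk].
  rewrite sumr_const -[in leRHS]mulr_natl mulrA [_ * y]mulrC.
  rewrite -!mulrA ler_wpM2l // ler_wpM2r ?weight_ge0 // ler_nat.
  rewrite -Sk -cardsDS // subset_leq_card //; apply/subsetP => v.
  by rewrite !inE => /andP[vS vA]; rewrite unfold_in vA vS SA Sk eqxx.
by apply: ler_sum => v vA; rewrite ler_wpM2r ?wsum_ge0 // yx.
Qed.

End WeightedSums.

(** * Binomial estimates *)

(** Otherwise (q+1) C(n,q+1) = (n-q) C(n,q) <= q 2^(q-1) C(n,q), and multiplying the hypothesis by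
    q+1 leaves C(n,q) < q+1, against C(n,q) >= C(q+1,q). *)
Lemma binomial_gap (n q : nat) : (0 < q)%N -> (0 < 'C(n, q))%N ->
  (2 ^ q * 'C(n, q) < 2 * 'C(n, q.+1) + 2 ^ q)%N ->
  (q * 2 ^ q.-1 < n - q)%N.
Proof.
move=> q0 N0 h.
have qn : (q < n)%N.
  rewrite ltnNge; apply/negP => nq; move: h.
  by rewrite [X in (2 * X)%N]bin_small ?ltnS // muln0 add0n ltnNge leq_pmulr.
have Nq : (q.+1 <= 'C(n, q))%N by rewrite -{1}(binSn q) leq_bin2l.
have step := mul_bin_left n q.
have pq : (2 ^ q = 2 * 2 ^ q.-1)%N by rewrite -expnS prednK.
have p0 : (0 < 2 ^ q.-1)%N by rewrite expn_gt0.
move: h; rewrite pq => h; rewrite ltnNge; apply/negP => gap.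
nia.
Qed.

(** For q >= 2 this follows from q C(n,q) = (n-q+1) C(n,q-1) and C(n,q-1) >= q >= 2. *)
Lemma pow2_le_bin (n q : nat) : (0 < q)%N -> (q * 2 ^ q.-1 < n - q)%N ->
  (2 ^ q <= 'C(n, q))%N.
Proof.
case: q => [//|[|q]] _ /= gap; first by rewrite bin1; lia.
have step := mul_bin_left n q.+1.
have h : ('C(n, q.+1) >= q.+2)%N.
  rewrite -(binSn q.+1) leq_bin2l //; lia.
move: gap; rewrite !expnS; set P := (2 ^ q)%N => gap; nia.
Qed.

(** * Real inequalities *)

Section Numeric.
Variable R : realFieldType.

(** Induction, since (1 - (p+1) h) (1 + h) = 1 - p h - (p+1) h^2. *)
Lemma bernoulli_reverse (h : R) (p : nat) : 0 <= h ->
  (1 - p%:R * h) * (1 + h) ^+ p <= 1.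
Proof.
move=> h0; elim: p => [|p IH]; first by rewrite mul0r subr0 mulr1.
apply: le_trans IH; rewrite exprS mulrA ler_wpM2r ?exprn_ge0 //; first by lra.
have := ler0n R p; rewrite -natr1; nra.
Qed.

(** For p >= 3, 2 (2^p - 5/4) >= 7 p / 2, so [bernoulli_reverse] bounds the left side by 7/2. *)
Lemma growth_bound (h : R) (p : nat) : 0 <= h -> (0 < p)%N ->
  (7 / 2 - 2 * h * (2 ^+ p - 5 / 4)) * (1 + h) ^+ p <= 2 * 2 ^+ p + 2.
Proof.
move=> h0; case: p => [//|[|[|p]]] _.
- rewrite !expr1; nra.
- rewrite (_ : 2 ^+ 2 = 4 :> R); last by rewrite expr2; lra.
  (* The first factor changes sign at h = 7/11. *)
  rewrite expr2; have [h1|h1] := leP h (7 / 11); first by nra.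
  apply: (@le_trans _ _ 0); last by lra.
  rewrite mulr_le0_ge0 ?mulr_ge0 //; nra.
- have b := bernoulli_reverse p.+3 h0.
  have lin : p.+3%:R * (7 / 2) <= 2 * (2 ^+ p.+3 - 5 / 4) :> R.
    elim: p {b} => [|p IH]; first by rewrite !exprS expr0; lra.
    have : 8 <= 2 ^+ p.+3 :> R.
      by rewrite -natrX (ler_nat _ 8) (@leq_exp2l 2 3).
    move: IH; rewrite [2 ^+ p.+4]exprS -[p.+4%:R]natr1; lra.
  have s : 0 <= (1 + h) ^+ p.+3 by rewrite exprn_ge0 //; lra.
  have t : 0 <= 2 ^+ p.+3 :> R by rewrite exprn_ge0.
  apply: (@le_trans _ _ (7 / 2 * ((1 - p.+3%:R * h) * (1 + h) ^+ p.+3))).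
    rewrite [leRHS]mulrA ler_wpM2r //; nra.
  have : 8 <= 2 ^+ p.+3 :> R.
    by rewrite -natrX (ler_nat _ 8) (@leq_exp2l 2 3).
  lra.
Qed.

(** [e], [e1], [e2] stand for elementary symmetric sums of degrees p+1, p, p-1 over the clique
    without its heaviest and lightest vertices, [n1] for the number of p-sets there, [r] for a count
    of missing sets. *)
Lemma spread_contradiction (p : nat) (M y e e1 e2 n1 r : R) :
  (0 < p)%N -> 0 < y -> 2 * y < M -> 0 <= e1 -> 0 < n1 ->
  2 ^+ p * y * e1 <= e -> 4 * y * e2 <= e1 -> e1 <= M ^+ p * n1 ->
  (2 * (2 ^+ p) ^+ 2 + 2 * 2 ^+ p) * n1 <= r ->
  (M - 2 * y) * e + y ^+ p.+2 * r < y * (M + y) * e1 + M * y ^+ 2 * e2 ->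
  False.
Proof.
move=> p0 y0 yM e10 n10 he he2 he1 hr.
(* With M = 2 y (1 + h) and 4 y e2 <= e1, the last hypothesis becomes
   y^p r < (7/2 - 2 h (2^p - 5/4)) e1. *)
pose h := (M - 2 * y) / (2 * y).
have h0 : 0 < h by rewrite divr_gt0 //; lra.
have ME : M = 2 * y * (1 + h) by rewrite /h; field; rewrite gt_eqF.
have := growth_bound (ltW h0) p0; move: he he1 hr; set c := 2 ^+ p => he he1 hr gb.
have c1 : 2 <= c by rewrite /c -natrX (ler_nat _ 2) (@leq_exp2l 2 1).
have Y : 0 < y ^+ p by rewrite exprn_gt0.
apply/negP; rewrite -leNgt.
have k1 : M * y ^+ 2 * e2 <= M * y / 4 * e1.
  rewrite (_ : _ * e2 = M * y / 4 * (4 * y * e2)); last by field.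
  by rewrite ler_wpM2l // divr_ge0 // mulr_ge0 //; lra.
have k2 : (M - 2 * y) * (c * y * e1) <= (M - 2 * y) * e.
  by rewrite ler_wpM2l //; lra.
have k3 : y ^+ p.+2 * ((2 * c ^+ 2 + 2 * c) * n1) <= y ^+ p.+2 * r.
  by rewrite ler_wpM2l // exprn_ge0 // ltW.
apply: le_trans (lerD k2 k3); apply: (le_trans (lerD (lexx _) k1)).
(* The net coefficient of y^2 e1: y (M + y) gives 3 + 2 h, [k1] gives (1 + h) / 2 and [k2] takes
   away 2 c h. *)
pose X := 7 / 2 - 2 * h * (c - 5 / 4).
suff key : X * e1 <= y ^+ p * ((2 * c ^+ 2 + 2 * c) * n1).
  have Y2 : 0 <= y ^+ 2 by rewrite exprn_ge0 // ltW.
  rewrite [y ^+ p.+2]exprSr exprSr -subr_ge0.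
  have := ler_wpM2l Y2 key; rewrite -subr_ge0; congr (0 <= _).
  by rewrite /X ME; field.
have [X0|X0] := leP X 0.
  apply: (@le_trans _ _ 0); first by rewrite mulr_le0_ge0.
  by rewrite !mulr_ge0 ?(ltW Y) ?(ltW n10) //; nra.
apply: (le_trans (ler_wpM2l (ltW X0) he1)).
rewrite ME !exprMn -/c.
have : X * (1 + h) ^+ p * (c * y ^+ p * n1) <= (2 * c + 2) * (c * y ^+ p * n1).
  by rewrite ler_wpM2r // !mulr_ge0 ?(ltW Y) ?(ltW n10) //; lra.
congr (_ <= _); ring.
Qed.

(** Adding y times the first-order bound, a b times the co-link bound and the last hypothesis
    cancels [za], [zb], [sw] and [d]. Then a b <= y^2 allows division by a b. *)
Lemma swap_combine (M y a b e e1 e2 za zb sw d wa wb yq ra rb : R) :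
  0 < y -> 2 * y <= M -> 0 < a * b -> a <= y -> b <= y -> 0 <= a -> 0 <= b ->
  0 <= e -> 0 <= yq -> 0 <= ra -> 0 <= rb ->
  (M - y) * e <= a * za + b * zb + a * b * sw ->
  d + y * sw <= e + (M + y) * e1 + M * y * e2 ->
  y * yq * ra <= wa -> y * yq * rb <= wb ->
  a * (y * za + wa) + b * (y * zb + wb) < a * b * d ->
  (M - 2 * y) * e + y * yq * (ra + rb) < y * (M + y) * e1 + M * y ^+ 2 * e2.
Proof.
move=> y0 yM t0 ay by_ a0 b0 e0 yq0 ra0 rb0 kkt co wA wB lt.
have h1 := ler_wpM2l (ltW y0) kkt.
have h3 := ler_wpM2l (ltW t0) co.
have hA : a * b * (yq * ra) <= a * wa.
  rewrite -mulrA ler_wpM2l //; apply: le_trans wA.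
  by rewrite -mulrA ler_wpM2r // mulr_ge0.
have hB : a * b * (yq * rb) <= b * wb.
  rewrite [a * b]mulrC -mulrA ler_wpM2l //; apply: le_trans wB.
  by rewrite -[leRHS]mulrA ler_wpM2r // mulr_ge0.
have tle : a * b <= y * y by rewrite ler_pM.
have h4 : a * b * ((M - y) * e) <= y * y * ((M - y) * e).
  by rewrite ler_wpM2r // mulr_ge0 //; lra.
have h5 : y * ((M - y) * e) + a * b * (yq * (ra + rb))
    < a * b * (e + (M + y) * e1 + M * y * e2).
  clear - h1 h3 hA hB lt.
  lra.
have h6 := h5; rewrite -(ltr_pM2l y0) in h6.
rewrite -subr_gt0 -(pmulr_rgt0 _ t0).
rewrite -subr_gt0 in h6; rewrite -subr_ge0 in h4.
apply: (lt_le_trans (ltr_wpDr h4 h6)); rewrite le_eqVlt; apply/orP; left.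
by apply/eqP; ring.
Qed.

End Numeric.

(** [#|g|.+1 == q] and [#|g|.+2 == q] express the degrees q-1 and q-2 without truncated subtraction:
    the second sum is 0 when q = 1. *)
Lemma weight_spread_contradiction (R : realFieldType) (V : finType)
  (x : V -> R) (A : {set V}) (q r : nat) (M y : R) :
  (forall v, 0 <= x v) -> (forall v, v \in A -> y <= x v) ->
  (forall v, v \in A -> x v <= M) -> 0 < y -> 2 * y < M -> (0 < q)%N ->
  (q * 2 ^ q.-1 < #|A|.+2 - q)%N ->
  (2 ^ q * 'C(#|A|.+2, q) < r + 2 * 'C(#|A|, q) + 2 ^ q)%N ->
  (M - 2 * y) * esym x A q + y ^+ q.+1 * r%:R
  < y * (M + y) * wsum x [pred g : {set V} | (g \subset A) && (#|g|.+1 == q)]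
    + M * y ^+ 2 * wsum x [pred g : {set V} | (g \subset A) && (#|g|.+2 == q)] ->
  False.
Proof.
move=> x0 yx xM y0 yM; case: q => [//|[|p]] _ gap rbig.
  (* For q = 1 the two sums are 1 and 0, the count gives r >= 3, and (M - 2 y) y + 3 y^2 = y (M +
     y). *)
  have e1 : wsum x [pred g : {set V} | (g \subset A) && (#|g|.+1 == 1)] = 1.
    rewrite /wsum (big_pred1 set0) /weight ?big_set0 // => g.
    by rewrite /= eqSS cards_eq0; case: eqP => [->|]; rewrite ?sub0set ?andbF.
  have e2 : wsum x [pred g : {set V} | (g \subset A) && (#|g|.+2 == 1)] = 0.
    by rewrite /wsum big_pred0 // => g /=; case: (_ \subset _).
  have := esym_step 0 x0 (ltW y0) yx.
  rewrite e1 e2 {1}/esym [X in _ * X <= _]e1 subn0 !mulr1 mulr0 addr0 mul1r => he.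
  have kA : 1 <= #|A|%:R :> R by rewrite ler1n; lia.
  have r3 : 3 <= r%:R :> R by rewrite (ler_nat _ 3); move: rbig; rewrite !bin1; lia.
  apply/negP; rewrite -leNgt; set e := esym x A 1 in he *.
  have he' : y <= e by apply: le_trans he; rewrite ler_peMl // ltW.
  have := ler_wpM2l (_ : 0 <= M - 2 * y) he'; have := ler_wpM2l (sqr_ge0 y) r3.
  move=> h1 /(_ ltac:(lra)); lra.
set e1 := wsum x _; set e2 := wsum x _ => key.
have s0 : 0 <= e2 by exact: wsum_ge0.
have s1 : 0 <= e1 by exact: wsum_ge0.
have s2 : 0 <= esym x A p.+2 by exact: wsum_ge0.
have step1 : (#|A| - p.+1)%:R * y * e1 <= p.+2%:R * esym x A p.+2.
  exact: (esym_step p.+1 x0 (ltW y0) yx).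
have step2 : (#|A| - p)%:R * y * e2 <= p.+1%:R * e1.
  exact: (esym_step p x0 (ltW y0) yx).
have binstep := mul_bin_left #|A| p.+1.
have cp : (2 <= 2 ^ p.+1)%N by rewrite (@leq_exp2l 2 1).
have gap' : (p.+2 * 2 ^ p.+1 <= #|A| - p.+1)%N.
  by move: gap; rewrite subSS; case: #|A| => [|k] /=; lia.
have binp : (0 < 'C(#|A|, p))%N by rewrite bin_gt0; nia.
have n1 : (0 < 'C(#|A|, p.+1))%N by rewrite bin_gt0; nia.
apply: (@spread_contradiction R p.+1 M y (esym x A p.+2) e1 e2
          ('C(#|A|, p.+1))%:R r%:R) => //.
- by rewrite ltr0n.
- rewrite -(ler_pM2l (ltr0Sn R p.+1)); apply: le_trans step1.
  rewrite !mulrA ler_wpM2r // ler_wpM2r ?(ltW y0) //.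
  by rewrite -natrX -natrM ler_nat.
- rewrite -(ler_pM2l (ltr0Sn R p)); apply: le_trans step2.
  rewrite !mulrA ler_wpM2r // ler_wpM2r ?(ltW y0) // -natrM ler_nat.
  have : (p.+1 * 4 <= p.+2 * 2 ^ p.+1)%N.
    by case: (p) => [//|k]; rewrite !expnS; have := expn_gt0 2 k; nia.
  move: gap'; lia.
- have -> : ('C(#|A|, p.+1))%:R = #|[pred g : {set V} | (g \subset A) && (#|g|.+1 == p.+2)]|%:R :> R.
    by rewrite -wsum1 -(esym1 R).
  by apply: (@wsum_le_card _ _ x M A) => // h /andP[-> /eqP[->]].
(* Put c = 2^(p+1). Pascal's rule applied twice and C(|A|,p+2) >= c C(|A|,p+1) leave at least (2 c -
   2) c + 4 c = 2 c^2 + 2 c times C(|A|,p+1). *)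
- have : ((2 * (2 ^ p.+1) ^ 2 + 2 * 2 ^ p.+1) * 'C(#|A|, p.+1) <= r)%N.
    move: rbig; rewrite !binS [(2 ^ p.+2)%N]expnS -binS => rbig.
    set c := (2 ^ p.+1)%N in cp gap' rbig *.
    have hc : (c * 'C(#|A|, p.+1) <= 'C(#|A|, p.+2))%N.
      rewrite -(leq_pmul2l (ltn0Sn p.+1)) binstep mulnA leq_mul2r gap' orbT //.
    move: rbig hc binp cp; rewrite !binS; nia.
  by rewrite -(ler_nat R) natrM natrD !natrM !natrX.
Qed.

(** * Edges sorted by the two vertices outside the clique *)

Section CliqueOfCodimensionTwo.
Variables (R : realFieldType) (V : finType) (q : nat) (E : {set {set V}}).
Variables (K : {set V}) (a b : V).
Hypothesis E_uniform : forall e, e \in E -> #|e| = q.+2.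
Hypothesis ab : a != b.
Hypothesis KE : K = ~: [set a; b].
Hypothesis K_clique : forall e : {set V}, e \subset K -> #|e| = q.+2 -> e \in E.

(** [missing a], [missing b] and [colink] are N_a, N_b and D; uniformity forces the members of D to
    have size q. *)
Definition missing v := [pred h : {set V} |
  [&& h \subset K, #|h| == q.+1 & v |: h \notin E]].
Definition colink := [pred h : {set V} | (h \subset K) && (a |: (b |: h) \in E)].

Lemma subset_clique (S : {set V}) : (S \subset K) = (a \notin S) && (b \notin S).
Proof.
rewrite KE -disjoints_subset disjoint_sym.
by rewrite -setI_eq0 setIUl setU_eq0 !setI_eq0 !disjoints1.
Qed.

Lemma colink_card h : colink h -> h \subset K /\ #|h| = q.
Proof.
case/andP=> hK hE; split=> //; move: (hK); rewrite subset_clique => /andP[ah bh].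
have := E_uniform hE; rewrite !cardsU1 bh in_setU1 (negbTE ab) (negbTE ah) /=.
by rewrite !add1n => -[].
Qed.

Lemma wsum_link (z : V -> R) v : v \notin K ->
  wsum z [pred h : {set V} | (h \subset K) && (v |: h \in E)]
  = esym z K q.+1 - wsum z (missing v).
Proof.
move=> vK; apply/eqP; rewrite eq_sym subr_eq; apply/eqP.
rewrite /esym /wsum (bigID (fun h => v |: h \in E)) /=; congr (_ + _).
  apply: eq_bigl => h; rewrite -andbA; case: (boolP (h \subset K)) => //= hK.
  case: (boolP (_ \in E)) => [/E_uniform|]; rewrite ?andbF // cardsU1.
  have -> : v \notin h by apply: contra vK => /(subsetP hK).
  by rewrite add1n => -[->]; rewrite eqxx.
by apply: eq_bigl => h; rewrite -andbA.
Qed.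

(** Edges are sorted by their intersection with {a, b}; inside [K] every (q+2)-set is an edge. *)
Lemma wsum_decomposition (z : V -> R) :
  wsum z (mem E) = esym z K q.+2
    + z a * (esym z K q.+1 - wsum z (missing a))
    + z b * (esym z K q.+1 - wsum z (missing b))
    + z a * z b * wsum z colink.
Proof.
have aK : a \notin K by rewrite KE !inE eqxx.
have bK : b \notin K by rewrite KE !inE eqxx orbT.
rewrite -!wsum_link // (wsum_split2 z _ ab); congr (_ + _ * _ + _ * _ + _ * _);
  apply: eq_wsum => h /=; rewrite andbA -subset_clique //.
case: (boolP (h \subset K)) => //= hK.
apply/idP/eqP => [/E_uniform //|]; exact: K_clique.
Qed.

(** The decomposition at weights 1 counts the edges. *)
Lemma missing_count : (2 ^ q * 'C(#|K|, q) + #|E|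
    <= 'C(#|K|, q.+2) + 2 * 'C(#|K|, q.+1) + 2 ^ q)%N ->
  (2 ^ q * 'C(#|K|, q) + #|colink| <= #|missing a| + #|missing b| + 2 ^ q)%N.
Proof.
have := wsum_decomposition (fun=> 1); rewrite !esym1 !wsum1 !mul1r.
rewrite -!(ler_nat R) !natrD !natrM; lra.
Qed.

Lemma missing_card v h : missing v h -> h \subset K /\ #|h| = q.+1.
Proof. by case/and3P=> hK /eqP. Qed.

Lemma missing_le v : (#|missing v| <= 'C(#|K|, q.+1))%N.
Proof.
rewrite -cards_draws subset_leq_card //; apply/subsetP => h.
by rewrite unfold_in !inE => /and3P[-> ->].
Qed.

Lemma colink_le : (#|colink| <= 'C(#|K|, q))%N.
Proof.
rewrite -cards_draws subset_leq_card //; apply/subsetP => h.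
by rewrite unfold_in !inE => /colink_card[-> ->] /=.
Qed.

End CliqueOfCodimensionTwo.

(** * The contradiction from too large a Lagrangian *)

Section Contradiction.
Variables (R : realFieldType) (V : finType) (q : nat) (E : {set {set V}}).
Variables (K : {set V}) (a b : V).
Hypothesis q_gt0 : (0 < q)%N.
Hypothesis E_uniform : forall e, e \in E -> #|e| = q.+2.
Hypothesis ab : a != b.
Hypothesis KE : K = ~: [set a; b].
Hypothesis K_clique : forall e : {set V}, e \subset K -> #|e| = q.+2 -> e \in E.
Variable x : V -> R.
Hypothesis x_ge0 : forall v, 0 <= x v.

Local Notation missing := (missing q E K).
Local Notation colink := (colink E K a b).

Section TwoVertices.
Variables i j : V.
Hypotheses (ij : i != j) (iK : i \in K) (jK : j \in K).
Let K' := K :\ i :\ j.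

Definition missing_at v := [pred g : {set V} |
  [&& g \subset K', #|g| == q & v |: (j |: g) \notin E]].

(* The sets g such that g + a + b + i witnesses an edge that does not survive
   the replacement of i by j. *)
Definition colink_swap := [pred g : {set V} |
  [&& g \subset K', #|g|.+1 == q, a |: (b |: (i |: g)) \in E
    & a |: (b |: (j |: g)) \notin E]].

Lemma subset_K' (S : {set V}) :
  (S \subset K') = [&& i \notin S, j \notin S & S \subset K].
Proof. by rewrite /K' !subsetD1; case: (i \in S); case: (j \in S); case: (S \subset K). Qed.

Lemma wsum_missing_at (z : V -> R) v :
  wsum z [pred h | missing v h && ((j \in h) && (i \notin h))]
  = z j * wsum z (missing_at v).
Proof.
rewrite (wsum_split z j) /= [X in X + _]big_pred0 => [|S]; last first.
  by rewrite /=; case: (j \in S); rewrite ?andbF.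
rewrite add0r; congr (_ * _); apply: eq_wsum => S /=.
rewrite setU11 subset_K' subUset sub1set jK cardsU1 in_setU1 (negbTE ij) /=.
by case: (j \in S); case: (i \in S); case: (S \subset K); rewrite ?andbF ?andbT.
Qed.

Lemma missing_split v : wsum x (missing v) = x j * wsum x (missing_at v)
  + wsum x [pred h | missing v h && ~~ ((j \in h) && (i \notin h))].
Proof.
rewrite -wsum_missing_at /wsum (bigID (fun h : {set V} => (j \in h) && (i \notin h))) /=.
by congr (_ + _); apply: eq_bigl => h; rewrite /= -?andbA.
Qed.

(** A missing set with [j] and without [i] is determined by its other q elements, which lie in
    K'. *)
Lemma missing_rest_card v : (#|missing v| <=
  #|[pred h | missing v h && ~~ ((j \in h) && (i \notin h))]| + 'C(#|K'|, q))%N.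
Proof.
have C : (#|[pred h | missing v h && ((j \in h) && (i \notin h))]| <= 'C(#|K'|, q))%N.
  have := wsum_missing_at (fun=> 1) v; rewrite !wsum1 mul1r => /eqP.
  rewrite eqr_nat => /eqP ->.
  rewrite -cards_draws subset_leq_card //; apply/subsetP => h.
  by rewrite unfold_in !inE => /and3P[-> ->].
rewrite addnC; apply: leq_trans (leq_add C (leqnn _)).
rewrite -(cardID [pred h : {set V} | (j \in h) && (i \notin h)] (missing v)).
by apply: leq_add; apply/eq_leq/eq_card => h; rewrite !inE // andbC.
Qed.

(** Only sets S with i + S an edge and j + S a non-edge matter; they are sorted by their
    intersection with {a, b}. *)
Lemma swap_bound :
  wsum x [pred S : {set V} | [&& i \notin S, j \notin S & i |: S \in E]]
    - wsum x [pred S : {set V} | [&& i \notin S, j \notin S & j |: S \in E]]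
  <= x a * wsum x (missing_at a) + x b * wsum x (missing_at b)
     + x a * x b * wsum x colink_swap.
Proof.
have aK : a \notin K by rewrite KE !inE eqxx.
have bK : b \notin K by rewrite KE !inE eqxx orbT.
pose P := [pred S : {set V} | [&& i \notin S, j \notin S, i |: S \in E & j |: S \notin E]].
apply: (@le_trans _ _ (wsum x P)).
  rewrite lerBlDl; rewrite [leLHS]/wsum (bigID (fun S : {set V} => j |: S \in E)) /=.
  apply: lerD; first by apply: wsum_le => // S /= /andP[/and3P[-> -> _] ->].
  by apply: wsum_le => // S /= /andP[/and3P[-> -> ->] ->].
have card2 (S : {set V}) u v : S \subset K' -> u \notin K -> v \in [set i; j] ->
    u |: (v |: S) \in E -> #|S| = q.
  rewrite subset_K' => /and3P[iS jS SK] uK vij /E_uniform.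
  have uS : u \notin S by apply: contra uK => /(subsetP SK).
  have vS : v \notin S by move: vij; rewrite !inE => /orP[] /eqP ->.
  have uv : u != v.
    apply: contraNneq uK => ->; by move: vij; rewrite !inE => /orP[] /eqP ->.
  by rewrite !cardsU1 vS in_setU1 (negbTE uv) (negbTE uS) !add1n => -[].
(* No such S lies inside [K], where j + S would be an edge of the clique. *)
rewrite (wsum_split2 x P ab) [X in X + _ + _ + _]big_pred0 ?add0r; last first.
  move=> S /=; rewrite andbA -(subset_clique KE); apply/negP.
  case/and5P=> SK iS jS iSE; apply/negP; rewrite negbK; apply: K_clique.
    by rewrite subUset sub1set jK.
  by have := E_uniform iSE; rewrite !cardsU1 iS jS.
apply: lerD; first apply: lerD; apply: ler_wpM2l; rewrite ?mulr_ge0 //;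
    apply: wsum_le => // S /=; rewrite andbA -(subset_clique KE) => /and5P[SK].
- rewrite !in_setU1 !negb_or => /andP[_ iS] /andP[_ jS] iE jE.
  have SK' : S \subset K' by rewrite subset_K' iS jS.
  rewrite SK' setUCA jE andbT; apply/eqP.
  by apply: (@card2 S a i) => //; rewrite ?inE ?eqxx // setUCA.
- rewrite !in_setU1 !negb_or => /andP[_ iS] /andP[_ jS] iE jE.
  have SK' : S \subset K' by rewrite subset_K' iS jS.
  rewrite SK' setUCA jE andbT; apply/eqP.
  by apply: (@card2 S b i) => //; rewrite ?inE ?eqxx // setUCA.
- rewrite !in_setU1 !negb_or => /and3P[_ _ iS] /and3P[_ _ jS] iE jE.
  have SK' : S \subset K' by rewrite subset_K' iS jS.
  have iE' : a |: (b |: (i |: S)) \in E.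
    by rewrite (setUCA [set b]) (setUCA [set a]).
  rewrite SK' iE' (setUCA [set b]) (setUCA [set a]) jE !andbT.
  have hC : colink (i |: S) by rewrite /= iE' subUset sub1set iK SK.
  by have [_ <-] := colink_card E_uniform ab KE hC; rewrite cardsU1 iS add1n eqxx.
Qed.

(** [colink] is sorted by intersection with {i, j}. If g is in [colink_swap] then j + g is not in
    [colink], so the two families share one sum of degree q-1. *)
Lemma colink_bound :
  wsum x colink + x j * wsum x colink_swap <=
    esym x K' q
    + (x i + x j) * wsum x [pred g : {set V} | (g \subset K') && (#|g|.+1 == q)]
    + x i * x j * wsum x [pred g : {set V} | (g \subset K') && (#|g|.+2 == q)].
Proof.
rewrite (wsum_split2 x colink ij).
set c0 := wsum x _; set ci := wsum x _; set cj := wsum x _; set cij := wsum x _.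
set sw := wsum x colink_swap; set e := esym _ _ _.
set e1 := wsum x _; set e2 := wsum x _.
have card := colink_card E_uniform ab KE.
have h0 : c0 <= e.
  apply: wsum_le => // S /and3P[iS jS] /[dup] /andP[SK _] /card[_ <-].
  by rewrite /= subset_K' iS jS SK eqxx.
have hi : ci <= e1.
  apply: wsum_le => // S /and3P[iS jS] /card[].
  rewrite /= subUset sub1set => /andP[_ SK] <-.
  by rewrite subset_K' iS jS SK cardsU1 iS add1n eqxx.
have hj : cj + sw <= e1.
  apply: wsum_le2 => // S.
  - case/and3P=> iS jS /card[]; rewrite /= subUset sub1set => /andP[_ SK] <-.
    by rewrite subset_K' iS jS SK cardsU1 jS add1n eqxx.
  - by case/and4P=> /= -> ->.
  - by case/and3P=> iS jS /andP[_ jE]; apply/negP => /and4P[_ _ _]; rewrite jE.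
have hij : cij <= e2.
  apply: wsum_le => // S /and3P[iS jS] /card[].
  rewrite /= !subUset !sub1set => /and3P[_ _ SK] <-.
  by rewrite subset_K' iS jS SK !cardsU1 jS in_setU1 (negbTE ij) iS !add1n eqxx.
have := ler_wpM2l (x_ge0 i) hi; have := ler_wpM2l (x_ge0 j) hj.
have := ler_wpM2l (mulr_ge0 (x_ge0 i) (x_ge0 j)) hij; lra.
Qed.

End TwoVertices.

Hypothesis x_top : forall v, v \in K -> x a <= x v /\ x b <= x v.
Hypothesis x_kkt : forall i j, i != j -> 0 < x i ->
  (x i - x j) * wsum x [pred S : {set V} |
     [&& i \notin S, j \notin S & i |: (j |: S) \in E]]
  <= wsum x [pred S : {set V} | [&& i \notin S, j \notin S & i |: S \in E]]
     - wsum x [pred S : {set V} | [&& i \notin S, j \notin S & j |: S \in E]].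
Hypothesis excess :
  esym x K q.+2 + (x a + x b) * esym x K q.+1 < wsum x (mem E).
Hypothesis few_edges : (2 ^ q * 'C(#|K|, q) + #|E|
  <= 'C(#|K|, q.+2) + 2 * 'C(#|K|, q.+1) + 2 ^ q)%N.

(** The starred inequality of the sketch: the common terms of [excess] and [wsum_decomposition]
    cancel. *)
Lemma missing_lt_colink :
  x a * wsum x (missing a) + x b * wsum x (missing b)
  < x a * x b * wsum x colink.
Proof. by have := excess; rewrite (wsum_decomposition E_uniform ab KE K_clique x); lra. Qed.

Lemma xab_gt0 : 0 < x a * x b.
Proof.
rewrite lt_neqAle mulr_ge0 // andbT; apply/eqP => ab0.
have := missing_lt_colink; rewrite -ab0 mul0r; apply/negP; rewrite -leNgt.
by rewrite addr_ge0 // mulr_ge0 // wsum_ge0.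
Qed.

Lemma colink_nonempty : (0 < #|colink|)%N.
Proof.
rewrite lt0n; apply/eqP => /card0_eq D0.
have := missing_lt_colink; rewrite [wsum x colink]/wsum big_pred0 ?mulr0.
  by apply/negP; rewrite -leNgt addr_ge0 // mulr_ge0 // wsum_ge0.
exact: D0.
Qed.

(** D is non-empty and N_a, N_b have at most C(n,q+1) members each, so [missing_count] gives the
    hypothesis of [binomial_gap]. *)
Lemma clique_gap : (q * 2 ^ q.-1 < #|K| - q)%N.
Proof.
have cnt := missing_count R E_uniform ab KE K_clique few_edges.
have D0 := colink_nonempty.
have := colink_le E_uniform ab KE; have := missing_le q E K a.
have := missing_le q E K b => hb ha hD.
by apply: binomial_gap => //; lia.
Qed.

Lemma excess_spread i j : i \in K -> j \in K ->
  (forall v, v \in K -> x v <= x i) -> (forall v, v \in K -> x j <= x v) ->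
  2 * x j < x i.
Proof.
move=> iK jK ximax xjmin; rewrite ltNge; apply/negP => Mle.
have t0 := xab_gt0; have y0 := x_ge0 j.
have cnt := missing_count R E_uniform ab KE K_clique few_edges.
have Dle := colink_le E_uniform ab KE.
have N2 := pow2_le_bin q_gt0 clique_gap.
have hD : wsum x colink <= (2 * x j) ^+ q * #|colink|%:R.
  apply: (@wsum_le_card _ _ x _ K) => // [v /ximax vi|h].
    exact: le_trans vi Mle.
  exact: (colink_card E_uniform ab KE).
have hN v : x j ^+ q.+1 * #|missing v|%:R <= wsum x (missing v).
  by apply: (@wsum_ge_card _ _ x _ K) => //; exact: missing_card.
have [aj bj] := x_top jK.
have hv v w : x w <= x j -> x v * x w * (x j ^+ q * #|missing v|%:R)
    <= x v * wsum x (missing v).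
  move=> wj; rewrite -mulrA ler_wpM2l //; apply: le_trans (hN v).
  by rewrite exprS -mulrA ler_wpM2r // mulr_ge0 // exprn_ge0.
(* As |D| <= C(n,q) and 2^q <= C(n,q), the lower bound 2^q (C(n,q) - 1) + |D| is at least 2^q
   |D|. *)
have count : (2 ^ q * #|colink| <= #|missing a| + #|missing b|)%N.
  by clear - cnt Dle N2; nia.
have := missing_lt_colink; apply/negP; rewrite -leNgt.
apply: (@le_trans _ _ (x a * x b * (x j ^+ q * (#|missing a| + #|missing b|)%:R))); last first.
  rewrite natrD !mulrDr lerD ?hv // [x a * x b]mulrC; exact: hv.
rewrite ler_wpM2l ?(ltW t0) //; apply: (le_trans hD).
rewrite exprMn mulrAC [leLHS]mulrC ler_wpM2l ?exprn_ge0 //.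
by rewrite -natrX mulr_natl -mulrnA ler_nat mulnC.
Qed.

Lemma no_excess : False.
Proof.
have gap := clique_gap.
have /card_gt0P[k0 k0K] : (0 < #|K|)%N by lia.
case: (@arg_maxP _ _ _ k0 (mem K) x k0K) => i iK0 ximax; have {iK0} iK : i \in K := iK0.
case: (@arg_minP _ _ _ k0 (mem K) x k0K) => j jK0 xjmin; have {jK0} jK : j \in K := jK0.
have spread := excess_spread iK jK ximax xjmin.
have t0 := xab_gt0; have [aj bj] := x_top jK.
have y0 : 0 < x j.
  have a0 : 0 < x a.
    rewrite lt_neqAle x_ge0 andbT; apply: contraTneq t0 => <-.
    by rewrite mul0r ltxx.
  exact: lt_le_trans aj.
have ij : i != j by apply: contraTneq spread => ->; rewrite -leNgt; lra.
have xi0 : 0 < x i by lra.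
have cK' : #|K| = (#|K :\ i :\ j|).+2.
  by rewrite (cardsD1 i K) iK (cardsD1 j (K :\ i)) !inE eq_sym ij jK.
have cnt := missing_count R E_uniform ab KE K_clique few_edges.
have D0 := colink_nonempty.
have rA := missing_rest_card ij jK a; have rB := missing_rest_card ij jK b.
have sA := missing_split ij jK a; have sB := missing_split ij jK b.
have swap := swap_bound iK jK; have co := colink_bound ij.
have kkt := le_trans (x_kkt ij xi0) swap.
have lt := missing_lt_colink.
set K' := K :\ i :\ j in cK' rA rB sA sB swap co kkt *.
have K'min v : v \in K' -> x j <= x v by rewrite !inE => /and3P[_ _ /xjmin].
have K'max v : v \in K' -> x v <= x i by rewrite !inE => /and3P[_ _ /ximax].
(* This bounds from below the factor of [x i - x j] in [kkt]. *)
have Lge : esym x K' q <= wsum x [pred S : {set V} |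
     [&& i \notin S, j \notin S & i |: (j |: S) \in E]].
  apply: wsum_le => // S /andP[]; rewrite subset_K' => /and3P[iS jS SK] /eqP Sq.
  rewrite /= iS jS; apply: K_clique; first by rewrite !subUset !sub1set iK jK.
  by rewrite !cardsU1 jS in_setU1 (negbTE ij) iS Sq.
move: sA sB rA rB; set restA := [pred h | _ && _]; set restB := [pred h | _ && _].
have wrest v : x j ^+ q.+1 * #|[pred h | missing v h && ~~ ((j \in h) && (i \notin h))]|%:R
    <= wsum x [pred h | missing v h && ~~ ((j \in h) && (i \notin h))].
  by apply: (@wsum_ge_card _ _ x _ K) => // h /andP[/missing_card].
move: (wrest a) (wrest b); rewrite -/restA -/restB => wA wB sA sB rA rB.
have key : (x i - 2 * x j) * esym x K' q + x j ^+ q.+1 * (#|restA| + #|restB|)%:R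
  < x j * (x i + x j) * wsum x [pred g : {set V} | (g \subset K') && (#|g|.+1 == q)]
    + x i * x j ^+ 2 * wsum x [pred g : {set V} | (g \subset K') && (#|g|.+2 == q)].
  set e1 := wsum x [pred g : {set V} | (g \subset K') && (#|g|.+1 == q)] in co *.
  set e2 := wsum x [pred g : {set V} | (g \subset K') && (#|g|.+2 == q)] in co *.
  have L_ge0 : 0 <= esym x K' q by exact: wsum_ge0.
  have := swap_combine y0 (ltW spread) t0 aj bj (x_ge0 a) (x_ge0 b) L_ge0
    (exprn_ge0 q (ltW y0)) (ler0n R #|restA|) (ler0n R #|restB|).
  rewrite -exprS -natrD; apply; [|exact: co|exact: wA|exact: wB|].
    by apply: le_trans kkt; rewrite ler_wpM2l //; lra.
  by rewrite -sA -sB.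
apply: (weight_spread_contradiction x_ge0 K'min K'max y0 spread q_gt0 _ _ key).
  by rewrite -cK'.
(* Since |D| > 0, the count of the remaining missing sets is strict. *)
rewrite -cK'; clear - cnt D0 rA rB.
move: (2 ^ q * _)%N cnt => N cnt; lia.
Qed.

End Contradiction.

(** * Shifting edges from one vertex to another *)

Section Shifting.
Variables (R : realFieldType) (V : finType) (E : {set {set V}}) (j v : V).
Hypothesis jv : j != v.
Implicit Types e f : {set V}.

(** An edge moves only if its image is not yet an edge, which makes the map injective on [E]. *)
Definition shift_set e :=
  if [&& j \in e, v \notin e & v |: (e :\ j) \notin E] then v |: (e :\ j) else e.

Definition shift_family : {set {set V}} := [set shift_set e | e in E].

Lemma exchangeK e : j \in e -> v \notin e -> j |: ((v |: (e :\ j)) :\ v) = e.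
Proof. by move=> je ve; rewrite setU1K ?setD1K // !inE (negbTE ve) andbF. Qed.

Lemma shift_set_inj : {in E &, injective shift_set}.
Proof.
move=> e f eE fE; rewrite /shift_set; case: ifP => [/and3P[je ve eE']|_];
  case: ifP => [/and3P[jf vf fE']|_] // ef.
- by rewrite -(exchangeK je ve) ef exchangeK.
- by rewrite ef fE in eE'.
- by rewrite -ef eE in fE'.
Qed.

Lemma card_shift_set e : #|shift_set e| = #|e|.
Proof.
rewrite /shift_set; case: ifP => // /and3P[je ve _].
by rewrite cardsU1 !inE (negbTE ve) andbF /= (cardsD1 j e) je.
Qed.

Lemma card_shift_family : #|shift_family| = #|E|.
Proof. exact: card_in_imset shift_set_inj. Qed.

(** The sets in question avoid [j], so edges among them stay. A non-edge e among them contains [v],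
    and e - v + j is an edge inside [K] whose shift is e. *)
Lemma shift_clique r (K : {set V}) : j \in K -> v \notin K ->
  (forall e, e \subset K -> #|e| = r -> e \in E) ->
  forall e, e \subset v |: (K :\ j) -> #|e| = r -> e \in shift_family.
Proof.
move=> jK vK KE e eK er.
have je : j \notin e.
  by apply/negP => /(subsetP eK); rewrite !inE eqxx (negbTE jv).
have fixed : e \in E -> e \in shift_family.
  move=> eE; apply/imsetP; exists e => //.
  by rewrite /shift_set (negbTE je).
case: (boolP (v \in e)) => ve; last first.
  apply: fixed; apply: KE => //; apply/subsetP => u ue.
  have := subsetP eK u ue; rewrite !inE => /orP[/eqP uv|/andP[]//].
  by rewrite -uv ue in ve.
case: (boolP (e \in E)) => [/fixed //|eE].
have fE : j |: (e :\ v) \in E.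
  apply: KE; last by rewrite cardsU1 !inE (negbTE je) andbF /= -er (cardsD1 v e) ve.
  rewrite subUset sub1set jK; apply/subsetP => u; rewrite !inE => /andP[uv ue].
  by have := subsetP eK u ue; rewrite !inE (negbTE uv) => /andP[].
have back : v |: ((j |: (e :\ v)) :\ j) = e.
  by rewrite setU1K ?setD1K // !inE (negbTE je) andbF.
apply/imsetP; exists (j |: (e :\ v)) => //.
by rewrite /shift_set back eE !inE !eqxx (eq_sym v) (negbTE jv).
Qed.

Lemma shift_family_wsum (x : V -> R) : (forall u, 0 <= x u) -> x j <= x v ->
  wsum x (mem E) <= wsum x (mem shift_family).
Proof.
move=> x0 xjv; rewrite /wsum [leRHS]big_imset /=; last exact: shift_set_inj.
apply: ler_sum => e eE; rewrite /shift_set; case: ifP => // /and3P[je ve _].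
have -> : weight x e = x j * weight x (e :\ j).
  by rewrite -weightU1 ?setD1K // setD11.
by rewrite weightU1 ?ler_wpM2r ?weight_ge0 // !inE (negbTE ve) andbF.
Qed.

End Shifting.

(** * The first-order condition, and transport of symmetric sums *)

Section Optimality.
Variables (R : realFieldType) (V : finType).

(** Moving weight d from [i] to [j] changes the sum by d (g - d L), with g the left side minus the
    right side and L the coefficient of [x i * x j]. A small d forces g <= 0. *)
Lemma optimal_kkt (P : pred {set V}) (x : V -> R) : (forall v, 0 <= x v) ->
  (forall x' : V -> R, (forall v, 0 <= x' v) ->
     \sum_v x' v = \sum_v x v -> wsum x' P <= wsum x P) ->
  forall i j, i != j -> 0 < x i ->
  (x i - x j) * wsum x [pred S : {set V} |
     [&& i \notin S, j \notin S & P (i |: (j |: S))]]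
  <= wsum x [pred S : {set V} | [&& i \notin S, j \notin S & P (i |: S)]]
     - wsum x [pred S : {set V} | [&& i \notin S, j \notin S & P (j |: S)]].
Proof.
move=> x0 xopt i j ij xi0.
pose x' (d : R) v := if v == i then x i - d else if v == j then x j + d else x v.
have x'i d : x' d i = x i - d by rewrite /x' eqxx.
have x'j d : x' d j = x j + d by rewrite /x' eqxx eq_sym (negbTE ij).
have x'v d v : v != i -> v != j -> x' d v = x v by rewrite /x' => /negbTE-> /negbTE->.
have sum' d : \sum_v x' d v = \sum_v x v.
  rewrite [LHS](bigD1 i) // [RHS](bigD1 i) //= [\sum_(v | _) x' d v](bigD1 j) 1?eq_sym //=.
  rewrite [\sum_(v | v != i) x v](bigD1 j) 1?eq_sym //= x'i x'j.
  rewrite (eq_bigr x) => [|v /andP[vi vj]]; last exact: x'v.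
  by rewrite !addrA; congr (_ + _); ring.
have wE d (Q : pred {set V}) : wsum (x' d) [pred S : {set V} | [&& i \notin S, j \notin S & Q S]]
    = wsum x [pred S : {set V} | [&& i \notin S, j \notin S & Q S]].
  apply: eq_bigr => S /and3P[iS jS _]; apply: eq_bigr => v vS.
  by apply: x'v; apply: contraTneq vS => ->.
have opt d : 0 <= d <= x i -> wsum (x' d) P <= wsum x P.
  move=> /andP[d0 dxi]; apply: xopt => // v; rewrite /x'.
  by case: ifP => _; [rewrite subr_ge0|case: ifP => // _; rewrite addr_ge0].
move: opt; set Lij := wsum x [pred S | [&& _, _ & P (i |: (j |: S))]].
set Li := wsum x [pred S | [&& _, _ & P (i |: S)]].
set Lj := wsum x [pred S | [&& _, _ & P (j |: S)]] => opt.
have L0 : 0 <= Lij by exact: wsum_ge0.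
rewrite leNgt; apply/negP => lt.
pose g := (x i - x j) * Lij - (Li - Lj).
have g0 : 0 < g by rewrite subr_gt0.
(* The first bound keeps the weight of [i] nonnegative, the second gives d L < g; adding 1 avoids
   division by zero. *)
pose d := Num.min (x i) (g / (Lij + 1)).
have L1 : 0 < Lij + 1 by lra.
have d0 : 0 < d by rewrite lt_min xi0 divr_gt0.
have dx : d <= x i by rewrite ge_min lexx.
have dg : d * (Lij + 1) <= g by rewrite -ler_pdivlMr // ge_min lexx orbT.
have := opt d; rewrite (ltW d0) dx => /(_ isT).
rewrite !(wsum_split2 _ P ij) !wE x'i x'j -/Lij -/Li -/Lj => hle.
have : d * (g - d * Lij) <= 0 by rewrite /g; lra.
rewrite pmulr_rle0 //; lra.
Qed.

Lemma esym_imset (U : finType) (f : U -> V) (x : V -> R) k : injective f ->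
  esym (x \o f) [set: U] k = esym x [set f u | u in [set: U]] k.
Proof.
move=> f_inj; rewrite /esym /wsum.
rewrite (reindex_onto (fun S : {set U} => f @: S) (fun S => f @^-1: S)) /=.
  apply: eq_big => [S|S _]; last by rewrite /weight big_imset //= => ? ? _ _ /f_inj.
  rewrite subsetT imsetS ?subsetT // card_imset //=.
  suff -> : f @^-1: (f @: S) == S by rewrite andbT.
  by apply/eqP/setP => u; rewrite inE mem_imset.
move=> S /andP[SA _]; apply/setP => v; apply/imsetP/idP => [[u]|vS].
  by rewrite inE => uS ->.
by have /imsetP[u _ vu] := subsetP SA v vS; exists u; rewrite // inE -vu.
Qed.

End Optimality.

(** * Lower bounds for Lagrangians *)

Section Lagrangians.
Variable R : realType.

Lemma lagr_polyE r n (G : r_graph r n) (x : 'rV[R]_n) :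
  lagr_poly G x = wsum (x 0) (mem (edges G)).
Proof. by []. Qed.

Lemma row_simplex n (x : 'I_n -> R) : (forall v, 0 <= x v) -> \sum_v x v = 1 ->
  @simplex R n (\row_v x v).
Proof.
by move=> x0 x1; split=> [i|]; [rewrite mxE|rewrite -x1; apply: eq_bigr => i _; rewrite mxE].
Qed.

Lemma wsum_le_lagrangian r n (G : r_graph r n) (x : 'I_n -> R) : (0 < n)%N ->
  (forall v, 0 <= x v) -> \sum_v x v = 1 -> wsum x (mem (edges G)) <= lagrangian R G.
Proof.
move=> n0 x0 x1; have [_ /(_ _ (row_simplex x0 x1))] := lagrangian_max R G n0.
rewrite lagr_polyE; congr (_ <= _); apply: eq_bigr => S _.
by apply: eq_bigr => v _; rewrite mxE.
Qed.

(* The weight of b is moved to a, after which b is deleted. *)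
Lemma complete_lagrangian_ge p r (x : 'I_p.+1 -> R) (a b : 'I_p.+1) : a != b ->
  (forall v, 0 <= x v) -> \sum_v x v = 1 ->
  esym x (~: [set a; b]) r.+1 + (x a + x b) * esym x (~: [set a; b]) r
  <= lagrangian R (complete_graph r.+1 p).
Proof.
move=> ab x0 x1; set K := ~: _.
have p0 : (0 < p)%N.
  by case: p a b ab {x x0 x1 K} => [a b|//]; rewrite (ord1 a) (ord1 b).
pose x' v := if v == a then x a + x b else if v == b then 0 else x v.
have x'a : x' a = x a + x b by rewrite /x' eqxx.
have x'b : x' b = 0 by rewrite /x' eq_sym (negbTE ab) eqxx.
have x'0 v : 0 <= x' v.
  by rewrite /x'; case: ifP => _; [rewrite addr_ge0|case: ifP].
have x'1 : \sum_u x' (lift b u) = 1.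
  transitivity (\sum_v x' v).
    by rewrite [RHS](bigD1_ord b) //= x'b add0r; apply: eq_bigl => u; rewrite ?inE.
  rewrite -x1 [LHS](bigD1 a) // [RHS](bigD1 a) //=.
  rewrite [\sum_(v | _) x' v](bigD1 b) 1?eq_sym //=.
  rewrite [\sum_(v | v != a) x v](bigD1 b) 1?eq_sym //= x'a x'b add0r addrA.
  by congr (_ + _); apply: eq_bigr => v /andP[/negbTE va /negbTE vb]; rewrite /x' va vb.
apply: le_trans (wsum_le_lagrangian (complete_graph r.+1 p) p0 (fun u => x'0 (lift b u)) x'1).
have -> : wsum (x' \o lift b) (mem (edges (complete_graph r.+1 p)))
    = esym x' [set~ b] r.+1.
  (* [lift b] identifies the p vertices with the complement of [b]. *)
  rewrite (_ : [set~ b] = [set lift b u | u in [set: 'I_p]]).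
    rewrite -esym_imset; last exact: lift_inj.
    by apply: eq_wsum => S /=; rewrite inE subsetT.
  apply/setP => v; rewrite !inE; apply/idP/imsetP => [vb|[u _ ->]].
    by rewrite eq_sym in vb; have [u -> _] := unlift_some vb; exists u.
  by rewrite eq_sym neq_lift.
have xK (S : {set 'I_p.+1}) : S \subset K -> weight x' S = weight x S.
  move=> SK; apply: eq_bigr => v /(subsetP SK); rewrite !inE negb_or.
  by case/andP=> /negbTE va /negbTE vb; rewrite /x' va vb.
have sub (S : {set 'I_p.+1}) : (a \notin S) && (S \subset [set~ b]) = (S \subset K).
  by rewrite (subset_clique (erefl K)) subsetC sub1set inE.
rewrite /esym (wsum_split x' a) x'a lerD ?ler_wpM2l ?addr_ge0 //;
  rewrite le_eqVlt; apply/orP; left; apply/eqP.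
- rewrite /wsum; apply: eq_big => [S|S /andP[/xK->]//].
  by rewrite /= andbA sub.
- rewrite /wsum; apply: eq_big => [S|S /andP[/xK->]//].
  rewrite /= subUset sub1set !inE ab /= cardsU1 -sub.
  by case: (a \notin S) => //=.
Qed.

End Lagrangians.

(** * Choice of an extremal graph and clique *)

(** A boolean predicate on a finite type of pairs, so that [arg_maxP] applies. *)
Definition graph_with_clique (V : finType) (r m k : nat)
    (EK : {set {set V}} * {set V}) :=
  [&& [forall (e | e \in EK.1), #|e| == r], #|EK.1| == m, #|EK.2| == k
    & [forall e : {set V}, (e \subset EK.2) && (#|e| == r) ==> (e \in EK.1)]].

Lemma graph_with_cliqueP (V : finType) r m k (E : {set {set V}}) (K : {set V}) :
  reflect [/\ forall e, e \in E -> #|e| = r, #|E| = m, #|K| = k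
     & forall e : {set V}, e \subset K -> #|e| = r -> e \in E]
   (graph_with_clique r m k (E, K)).
Proof.
apply: (iffP and4P) => /= [[/forall_inP Er /eqP Em /eqP Kk /forallP KE]|[Er Em Kk KE]].
  split=> // [e /Er /eqP //|e eK er]; apply: (implyP (KE e)).
  by rewrite eK er eqxx.
split; [by apply/forall_inP => e /Er ->|exact/eqP|exact/eqP|].
by apply/forallP => e; apply/implyP => /andP[eK /eqP]; exact: KE.
Qed.

(* Among the graphs of maximal Lagrangian and their cliques, a pair for which
   the clique carries the largest possible weight. *)
Lemma exists_top_clique (R : realType) (p r m k : nat) (G : r_graph r p.+1)
    (K0 : {set 'I_p.+1}) :
  graph_with_clique r m k (edges G, K0) ->
  exists E K (x : 'I_p.+1 -> R),
    [/\ graph_with_clique r m k (E, K),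
        (forall v, 0 <= x v) /\ \sum_v x v = 1,
        lagrangian R G <= wsum x (mem E),
        forall x' : 'I_p.+1 -> R, (forall v, 0 <= x' v) -> \sum_v x' v = 1 ->
          wsum x' (mem E) <= wsum x (mem E)
      & forall u v, u \in K -> v \notin K -> x v <= x u].
Proof.
move=> ok0.
(* Defined on bare families, since a pair carries no proof of uniformity. *)
pose lag (EK : {set {set 'I_p.+1}} * {set 'I_p.+1}) : R :=
  sup [set wsum (x 0) (mem EK.1) | x in @simplex R p.+1]%classic.
have lagE EK : graph_with_clique r m k EK ->
    exists2 H : r_graph r p.+1, edges H = EK.1 & lagrangian R H = lag EK.
  case: EK => E K /graph_with_cliqueP[Er _ _ _].
  by exists (RGraph Er).
case: (@arg_maxP _ _ _ (edges G, K0) (graph_with_clique r m k) lag ok0) => EK1 ok1 max1.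
have [H1 H1E H1lag] := lagE _ ok1.
have [[xr xrS xrlag] _] := lagrangian_max R H1 (ltn0Sn p).
pose x := xr 0.
have x0 v : 0 <= x v by case: xrS.
have x1 : \sum_v x v = 1 by case: xrS.
(* The weighting [x] is now fixed; [P2] keeps the pairs whose value at [x] is still maximal. *)
pose P2 EK := graph_with_clique r m k EK && (lag EK1 <= wsum x (mem EK.1)).
have P21 : P2 EK1.
  by rewrite /P2 ok1 /= -H1lag -xrlag lagr_polyE H1E.
case: (@arg_maxP _ _ _ EK1 P2 (fun EK => \sum_(v in EK.2) x v) P21) => -[E K] /andP[ok2 ge2] max2.
have [H2 H2E H2lag] := lagE _ ok2.
exists E, K, x; split=> //.
- by apply: le_trans ge2; exact: (max1 (edges G, K0) ok0).
- move=> x' x'0 x'1; apply: le_trans ge2; apply: le_trans (max1 _ ok2).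
  rewrite -H2lag (_ : E = edges H2); last by rewrite H2E.
  exact: wsum_le_lagrangian.
- move=> u v uK vK; rewrite leNgt; apply/negP => xuv.
  have uv : u != v by apply: contraNneq vK => <-.
  have [Er Em Kk KE] := graph_with_cliqueP _ _ _ _ _ ok2.
  (* Shifting from [u] to the heavier [v] stays in [P2] but would make the clique heavier. *)
  have /max2 : P2 (shift_family E u v, v |: (K :\ u)).
    apply/andP; split; last first.
      by apply: le_trans ge2 _; apply: shift_family_wsum => //; exact: ltW.
    apply/graph_with_cliqueP; split.
    + by move=> e /imsetP[f fE ->]; rewrite card_shift_set Er.
    + by rewrite card_shift_family.
    + by rewrite cardsU1 !inE (negbTE vK) andbF /= -Kk (cardsD1 u K) uK.
    + exact: shift_clique.
  rewrite /= big_setU1 /=; last by rewrite !inE (negbTE vK) andbF.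
  by rewrite [leRHS](big_setD1 u uK) /= lerD2r leNgt xuv.
Qed.

Theorem theorem4p2 (R : realType) (r m t : nat) (hr : (3 <= r)%N)
  (hm : (0 < m)%N) (ht : (0 < t)%N)
  (hm_lower : ('C(t - 1, r) <= m)%N)
  (hm_upper : m%:Z <= 'C(t - 1, r)%:Z + 'C(t - 2, r - 1)%:Z
                      - 2%:Z ^+ (r - 2) * ('C(t - 2, r - 2)%:Z - 1))
  (G : r_graph r t) (hG_edges : #|edges G| = m)
  (hG_clique : contains_clique G (t - 2)) :
  lagrangian R G <= lagrangian R (complete_graph r (t - 1)).
Proof.
(* An edge exists because m > 0; hence t >= r >= 3 and t - 2 is not truncated. *)
have rt : (r <= t)%N.
  have /card_gt0P[e eG] : (0 < #|edges G|)%N by rewrite hG_edges.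
  by rewrite -(edges_card eG) -[leqRHS]card_ord max_card.
move: rt hr hm_upper; case: r G hG_edges hG_clique hm_lower => [//|[//|q]].
case: t ht => [//|[//|k]] _ G Gm [K0 [K0k K0G]] _ qk q0.
rewrite !subSS !subn0 in K0k *; rewrite binS => upper.
(* With k = t - 2 and q = r - 2, the subtracted term moves to the left, which gives an inequality of
   natural numbers. *)
have {}upper : (2 ^ q * 'C(k, q) + m <= 'C(k, q.+2) + 2 * 'C(k, q.+1) + 2 ^ q)%N.
  by move: upper; rewrite -(natrX _ 2 q); lia.
have ok0 : graph_with_clique q.+2 m k (edges G, K0).
  by apply/graph_with_cliqueP; split=> //; exact: edges_card.
have [E [K [x [/graph_with_cliqueP[Er Em Kk KE] [x0 x1] lagx xopt xtop]]]] :=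
  exists_top_clique R ok0.
apply: le_trans lagx _; rewrite leNgt; apply/negP => excess.
have /cards2P[a [b [ab abK]]] : #|~: K| == 2%N.
  by apply/eqP; have := cardsC K; rewrite Kk card_ord; lia.
have Kab : K = ~: [set a; b] by rewrite -abK setCK.
apply: (@no_excess R _ q E K a b _ Er ab Kab KE x x0).
- exact: q0.
- by move=> v vK; split; apply: xtop => //; rewrite Kab !inE eqxx ?orbT.
- by apply: optimal_kkt => // x' x'0; rewrite x1; exact: xopt.
- apply: le_lt_trans excess; rewrite Kab; exact: complete_lagrangian_ge.
- by rewrite Kk Em.
Qed.
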